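(* Let $G_1$ and $G_2$ be connected graphs, and for $i=1,2$ let $d_i$ be the diameter of $G_i$, with $d_i\ge 1$, and let $\gamma_i=\gamma(G_i)\in\{1,2,\dots\}\cup\{\infty\}$ be the exponent of $G_i$. If $G_1$ contains odd cycles, then the diameter of the Kronecker product is $$d(G_1\otimes G_2)=\begin{cases}\gamma_1 & \text{if }\gamma_1=\gamma_2,\\ \max\{\gamma_2+1,d_1\} & \text{if }\gamma_1>\gamma_2,\\ \max\{\gamma_1+1,d_2\} & \text{if }\gamma_1<\gamma_2.\end{cases}$$
   Context: Graphs are finite, undirected, without parallel edges, loops allowed, and nontrivial (at least two vertices). A loop is a cycle of length $1$, so it counts as an odd cycle. The diameter $d(G)$ is the maximum distance between two vertices ($\infty$ if $G$ is disconnected). The Kronecker product $G_1\otimes G_2$ has vertex set $V(G_1)\times V(G_2)$, and $(x_1,x_2)$, $(y_1,y_2)$ are adjacent iff $(x_1,y_1)\in E(G_1)$ and $(x_2,y_2)\in E(G_2)$. An $(x,y)$-walk of length $k$ is a sequence of $k+1$ vertices from $x$ to $y$, consecutive ones being adjacent (a vertex with a loop is adjacent to itself; repetitions allowed). The exponent $\gamma(G)$ is the minimum integer $\gamma\ge 0$ such that for any two (not necessarily distinct) vertices $x,y$ of $G$ and every integer $k\ge\gamma$ there is an $(x,y)$-walk of length $k$; if no such integer exists, $\gamma(G)=\infty$. Every finite integer is smaller than $\infty$. *)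

(* Defs.v *)
From mathcomp Require Import all_boot all_order all_algebra.
From mathcomp Require Import boolp constructive_ereal.

Set Implicit Arguments.
Unset Strict Implicit.
Unset Printing Implicit Defensive.

Import Order.TTheory GRing.Theory Num.Theory.

(* An edge with equal ends is a loop. *)
Record graph := Graph {
  vertex :> finType;
  edge : rel vertex;
  edge_sym : symmetric edge;
  graph_nontrivial : 1 < #|vertex| }.

Definition is_connected (G : graph) : Prop :=
  forall x y : G, connect (@edge G) x y.

(* ucycle: consecutive vertices (cyclically) are adjacent and all vertices are
   distinct. The list [:: x] is such a cycle exactly when x has a loop; the
   degenerate case of size 2 (an edge traversed back and forth) is even. *)
Definition has_odd_cycle (G : graph) : Prop :=
  exists2 c : seq G, ucycle (@edge G) c & odd (size c).

(* The k + 1 vertices of the walk are x :: p. *)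
Definition has_walk (G : graph) (x y : G) (k : nat) : Prop :=
  exists p : seq G, [/\ path (@edge G) x p, last x p = y & size p = k].

Definition has_path (G : graph) (x y : G) (k : nat) : Prop :=
  exists p : seq G,
    [/\ path (@edge G) x p, last x p = y, uniq (x :: p) & size p = k].

(* Lengths live in \bar int, which brings the order, the maximum and the
   addition of the extended numbers; only naturals and +oo are ever used. *)
Definition least (P : nat -> Prop) : \bar int :=
  match pselect (exists n, `[< P n >]) with
  | left exP => ((ex_minn exP)%:Z)%:E
  | right _ => +oo%E
  end.

Definition distance (G : graph) (x y : G) : \bar int := least (has_path x y).

Definition diameter (G : graph) : \bar int :=
  \big[maxe/0%E]_(p : G * G) distance p.1 p.2.

Definition exponent (G : graph) : \bar int :=
  least (fun g => forall (x y : G) (k : nat), g <= k -> has_walk x y k).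

Section Kronecker.
Variables G1 G2 : graph.

Definition kronecker_edge : rel (G1 * G2)%type :=
  fun u v => edge u.1 v.1 && edge u.2 v.2.

Lemma kronecker_edge_sym : symmetric kronecker_edge.
Proof. by move=> u v; rewrite /kronecker_edge !(edge_sym _ u.1, edge_sym _ u.2). Qed.

Lemma kronecker_nontrivial : 1 < #|{: G1 * G2}|.
Proof.
rewrite card_prod; apply: leq_trans (graph_nontrivial G1) _.
by rewrite leq_pmulr // ltnW // graph_nontrivial.
Qed.

Definition kronecker : graph := Graph kronecker_edge_sym kronecker_nontrivial.

End Kronecker.

(* Main.v *)
Require Import Defs.
From mathcomp Require Import all_boot all_order all_algebra.
From mathcomp Require Import boolp constructive_ereal.
From mathcomp Require Import zify.

(* Walks of a Kronecker product are pairs of walks of equal length. In a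
   connected graph the set of lengths of (x,y)-walks is closed under adding 2,
   and a pair without walk of length k.+1 yields, moving y to a neighbour, a
   pair without walk of length k. Hence for each m below the exponent some pair
   misses the length m, and all smaller lengths of that parity; combining such
   pairs of opposite parities in the two factors gives the lower bounds. For
   the upper bounds, past its exponent a factor has walks of every length, so
   only the parity imposed by the other factor matters. *)

Set Implicit Arguments.
Unset Strict Implicit.
Unset Printing Implicit Defensive.

Import Order.TTheory GRing.Theory Num.Theory.

(** * Least elements with values in the extended integers *)

Variant least_spec (P : nat -> Prop) : \bar int -> Prop :=
  | LeastFin n of P n & (forall m, P m -> n <= m) : least_spec P n%:Z%:E
  | LeastInf of (forall n, ~ P n) : least_spec P +oo%E.

Lemma leastP (P : nat -> Prop) : least_spec P (least P).
Proof.
rewrite /least; case: pselect => [exP|nexP].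
  case: ex_minnP => n /asboolP Pn min_n; constructor=> // m Pm.
  by apply: min_n; apply/asboolP.
by constructor=> n Pn; apply: nexP; exists n; apply/asboolP.
Qed.

Lemma least_leP (P : nat -> Prop) (n : nat) :
  (least P <= n%:Z%:E)%E <-> exists2 k, k <= n & P k.
Proof.
case: leastP => [m Pm min_m|nP]; rewrite ?lee_fin ?lez_nat.
  by split=> [le_mn|[k le_kn /min_m/leq_trans]]; [exists m | apply].
by split=> // -[k _ /nP].
Qed.

Lemma least_ge (P : nat -> Prop) (n : nat) :
  (forall k, k < n -> ~ P k) -> (n%:Z%:E <= least P)%E.
Proof.
move=> nP; case: leastP => [m Pm _|_]; last exact: leey.
by rewrite lee_fin lez_nat leqNgt; apply/negP => /nP.
Qed.

(** * Walks, distances and exponents in a single graph *)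

Section Walks.
Variable G : graph.
Implicit Types x y z : G.

Lemma walk1 x y : edge x y -> has_walk x y 1.
Proof. by move=> exy; exists [:: y]; rewrite /= exy. Qed.

Lemma walk_cat x y z m n :
  has_walk x y m -> has_walk y z n -> has_walk x z (m + n).
Proof.
move=> [p [ep <- <-]] [q [eq <- <-]]; exists (p ++ q).
by rewrite cat_path ep eq last_cat size_cat.
Qed.

Lemma path_walk x y k : has_path x y k -> has_walk x y k.
Proof. by case=> p [? ? _ ?]; exists p. Qed.

Lemma walk_path x y k : has_walk x y k -> exists2 j, j <= k & has_path x y j.
Proof.
case=> p [ep lp <-]; case/shortenP: ep lp => q eq uq sq lq.
exists (size q); last by exists q.
by apply: uniq_leq_size sq; case/andP: uq.
Qed.

(** Distances are defined by paths, but a walk shortens to a path. Walks are easier to use: they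
    concatenate and project to factors, while the projection of a path may repeat vertices. *)
Lemma distance_leP x y (n : nat) :
  (distance x y <= n%:Z%:E)%E <-> exists2 k, k <= n & has_walk x y k.
Proof.
split=> [/least_leP[k le_kn /path_walk wk]|[k le_kn /walk_path[j le_jk pj]]].
  by exists k.
by apply/least_leP; exists j => //; apply: leq_trans le_kn.
Qed.

Lemma distance_ge x y (n : nat) :
  (forall k, k < n -> ~ has_walk x y k) -> (n%:Z%:E <= distance x y)%E.
Proof. by move=> nw; apply: least_ge => k /nw nwk /path_walk. Qed.

Lemma distance_le_diameter x y : (distance x y <= diameter G)%E.
Proof. exact: (le_bigmax _ (fun p : G * G => distance p.1 p.2) (x, y)). Qed.

Lemma diameter_ge0 : (0 <= diameter G)%E.
Proof. exact: bigmax_ge_id. Qed.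

Lemma diameter_le e :
  (0 <= e)%E -> (forall x y, (distance x y <= e)%E) -> (diameter G <= e)%E.
Proof. by move=> e0 le_e; apply: bigmax_le => // -[x y] _; apply: le_e. Qed.

Lemma exponent_walk (g : nat) :
  exponent G = g%:Z%:E -> forall x y k, g <= k -> has_walk x y k.
Proof. by rewrite /exponent; case: leastP => // n wn _ [<-]. Qed.

Hypothesis conn : is_connected G.

Lemma ex_walk x y : exists k, has_walk x y k.
Proof.
have /connectP[p ep lp] := conn x y.
by exists (size p), p.
Qed.

Lemma ex_neighbour x : exists y, edge x y.
Proof.
have [y] : exists y, y != x.
  have /card_gt1P[a [b [_ _ neq_ab]]] := graph_nontrivial G.
  by have [<-|] := eqVneq a x; [exists b; rewrite eq_sym | exists a].
have /connectP[[|z p] /= ep ->] := conn x y; first by rewrite eqxx.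
by move=> _; exists z; case/andP: ep.
Qed.

Lemma walk_add_even x y m n :
  has_walk x y m -> m <= n -> odd m = odd n -> has_walk x y n.
Proof.
move=> wm le_mn odd_mn.
(* The surplus is spent going back and forth along one edge at [x]. *)
have -> : n = (n - m)./2.*2 + m by lia.
elim: (n - m)./2 => // i IHi; have [z exz] := ex_neighbour x.
rewrite (_ : _ + m = 1 + (1 + (i.*2 + m))); last by lia.
apply: walk_cat (walk1 exz) _; apply: walk_cat IHi.
by apply: walk1; rewrite edge_sym.
Qed.

Lemma no_walk_leq x y m n :
  ~ has_walk x y n -> m <= n -> exists z, ~ has_walk x z m.
Proof.
move=> nw /subnK def_n; rewrite -{}def_n in nw.
elim: (n - m) y nw => [|i IHi] y nw; first by exists y.
have [z eyz] := ex_neighbour y; apply: (IHi z) => wz; apply: nw.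
by rewrite addSn -addn1; apply: walk_cat wz _; apply: walk1; rewrite edge_sym.
Qed.

(** If length [m] were available to all pairs, so would be every larger length, by [no_walk_leq],
    and [m] would bound the exponent. *)
Lemma exponent_no_walk (m : nat) :
  (m%:Z%:E < exponent G)%E -> exists x y, ~ has_walk x y m.
Proof.
rewrite ltNge => /negP lt_m; apply: contrapT => all_w.
apply: lt_m; apply/least_leP; exists m => // x y k le_mk.
apply: contrapT => /no_walk_leq/(_ le_mk)[z nw].
by apply: all_w; exists x, z.
Qed.

Lemma odd_cycle_walk : has_odd_cycle G -> exists x k, odd k /\ has_walk x x k.
Proof.
case=> [[|x p]] // /andP[/= ep _] odd_p; exists x, (size p).+1; split=> //.
by exists (rcons p x); rewrite last_rcons size_rcons.
Qed.

(** Any two vertices are joined through a vertex [z] of the odd cycle, with or without a turn around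
    it. Both parities occur, hence all large lengths; finitely many pairs have a common
    threshold. *)
Lemma exponent_fin : has_odd_cycle G -> exists g : nat, exponent G = g%:Z%:E.
Proof.
move=> /odd_cycle_walk[z [c [odd_c wz]]].
have walk_ge (p : G * G) :
    exists g, forall k, g <= k -> has_walk p.1 p.2 k.
  have [[m wm] [n wn]] := (ex_walk p.1 z, ex_walk z p.2).
  exists (m + (c + n)) => k le_k.
  have [eq_odd|neq_odd] := eqVneq (odd (m + n)) (odd k).
    by apply: walk_add_even (walk_cat wm wn) _ eq_odd; lia.
  by apply: walk_add_even (walk_cat wm (walk_cat wz wn)) le_k _; lia.
have [g walk_g] := boolp.choice walk_ge.
have : (exponent G <= (\max_p g p)%:Z%:E)%E.
  apply/least_leP; exists (\max_p g p) => // x y k le_k.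
  by apply: (walk_g (x, y)); apply: leq_trans le_k; apply: leq_bigmax.
by rewrite /exponent; case: leastP => // n _ _ _; exists n.
Qed.

End Walks.

(** * Distances in the Kronecker product *)

Section Product.
Variables G1 G2 : graph.

Lemma walk_kroneckerP (u v : kronecker G1 G2) k :
  has_walk u v k <-> has_walk u.1 v.1 k /\ has_walk u.2 v.2 k.
Proof.
split=> [[p [ep <- <-]]|].
  by split; [exists (map fst p) | exists (map snd p)];
    rewrite size_map last_map; split=> //; apply: homo_path ep => a b /andP[].
case: u v => [x1 x2] [y1 y2] /= [[p [ep <- <-]] [q [eq <- eq_sz]]].
(* [zip] truncates to the shorter list, so the equality of lengths matters. *)
exists (zip p q).
elim: p q x1 x2 ep eq eq_sz => [|a p IHp] [|b q] //= x1 x2.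
move=> /andP[e1 ep] /andP[e2 eq] [eq_sz].
by have [-> -> ->] := IHp q a b ep eq eq_sz; rewrite /kronecker_edge /= e1 e2.
Qed.

(** A product walk of length at most [n] would extend, in steps of 2, to length [n] in [G1] or to
    length [n.-1] in [G2], according to its parity. For [n = 0] the first case is the only one, so
    any vertex of [G2] serves. *)
Lemma diameter_kronecker_ge (n : nat) :
  is_connected G1 -> is_connected G2 ->
  (exists x y : G1, ~ has_walk x y n) ->
  (0 < n -> exists x y : G2, ~ has_walk x y n.-1) ->
  (n.+1%:Z%:E <= diameter (kronecker G1 G2))%E.
Proof.
move=> conn1 conn2 [x1 [y1 nw1]] no_walk2.
have [x2 [y2 nw2]] :
    exists x2 y2 : G2, 0 < n -> ~ has_walk x2 y2 n.-1.
  case: (posnP n) => [->|/[dup] n_gt0 /no_walk2[x2 [y2 nw2]]]; last by exists x2, y2.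
  by have /card_gt0P[x _] := ltnW (graph_nontrivial G2); exists x, x.
apply: le_trans (@distance_le_diameter (kronecker G1 G2) (x1, x2) (y1, y2)).
apply: distance_ge => k; rewrite ltnS => le_kn /walk_kroneckerP[/= w1 w2].
have [eq_odd|neq_odd] := eqVneq (odd k) (odd n).
  by apply: nw1; apply: walk_add_even w1 le_kn eq_odd.
by apply: nw2; [lia | apply: walk_add_even w2 _ _ => //; lia].
Qed.

Lemma diameter_kronecker_lt :
  is_connected G1 -> is_connected G2 -> (exponent G2 < exponent G1)%E ->
  diameter (kronecker G1 G2) = maxe (exponent G2 + 1)%E (diameter G1).
Proof.
move=> conn1 conn2 lt_exp.
(* An exponent strictly below another one cannot be [+oo]. *)
have [g def_g] : exists g : nat, exponent G2 = g%:Z%:E.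
  move: lt_exp; rewrite {1 3}/exponent.
  by case: leastP => [n _ _ _|_]; [exists n | rewrite ltNge leey].
have def_g1 : (exponent G2 + 1)%E = g.+1%:Z%:E.
  by rewrite def_g -EFinD -PoszD addn1.
apply/eqP; rewrite def_g1 eq_le; apply/andP; split.
  apply: diameter_le => [|[x1 x2] [y1 y2]]; first by rewrite le_max diameter_ge0 orbT.
  have [d def_d] : exists d : nat, distance x1 y1 = d%:Z%:E.
    rewrite /distance; case: leastP => [d _ _|no_path]; first by exists d.
    by have [k /walk_path[j _ /no_path]] := ex_walk conn1 x1 y1.
  have [j le_jd wj] : exists2 k, k <= d & has_walk x1 y1 k.
    by apply/distance_leP; rewrite def_d.
  (* From length [g] on, [G2] imposes nothing. A shorter walk of [G1] is lengthened to [g] or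
     [g + 1], whichever has the parity of [j]. *)
  rewrite le_max; apply/orP; have [le_gj|lt_jg] := leqP g j; [right|left].
    apply: le_trans (distance_le_diameter x1 y1); rewrite def_d.
    apply/distance_leP; exists j => //; apply/walk_kroneckerP; split=> //=.
    exact: exponent_walk def_g _ _ _ le_gj.
  apply/distance_leP; exists (g + (odd g != odd j)); first by lia.
  apply/walk_kroneckerP; split=> /=; first by apply: walk_add_even wj _ _ => //; lia.
  by apply: exponent_walk def_g _ _ _ _; lia.
rewrite ge_max; apply/andP; split.
  apply: diameter_kronecker_ge => // [|g_gt0].
    by apply: exponent_no_walk => //; rewrite -def_g.
  by apply: exponent_no_walk => //; rewrite def_g lte_fin ltz_nat prednK.
(* Projecting to [G1] does not increase distances, so any fixed [z] in [G2] gives the bound. *)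
apply: diameter_le => [|x y]; first exact: diameter_ge0.
have /card_gt0P[z _] := ltnW (graph_nontrivial G2).
apply: le_trans (@distance_le_diameter (kronecker G1 G2) (x, z) (y, z)).
rewrite {2}/distance; case: leastP => [n pn _|_]; last exact: leey.
apply/distance_leP; exists n => //.
by have /walk_kroneckerP[] := path_walk pn.
Qed.

Lemma diameter_kronecker_eq (g : nat) :
  is_connected G1 -> is_connected G2 ->
  exponent G1 = g%:Z%:E -> exponent G2 = g%:Z%:E ->
  diameter (kronecker G1 G2) = g%:Z%:E.
Proof.
move=> conn1 conn2 def1 def2; apply/eqP; rewrite eq_le; apply/andP; split.
  apply: diameter_le => // u v; apply/distance_leP; exists g => //.
  by apply/walk_kroneckerP; split; [apply: exponent_walk def1 _ _ _ _
                                   | apply: exponent_walk def2 _ _ _ _].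
(* With common exponent [g.+1], the first factor misses length [g] and the second misses [g.-1]. *)
case: g def1 def2 => [|g] def1 def2; first exact: diameter_ge0.
apply: diameter_kronecker_ge => // [|_]; apply: exponent_no_walk => //.
  by rewrite def1 lte_fin ltz_nat.
by rewrite def2 lte_fin ltz_nat ltnS leq_pred.
Qed.

End Product.

Lemma diameter_kroneckerC_le (G1 G2 : graph) :
  (diameter (kronecker G1 G2) <= diameter (kronecker G2 G1))%E.
Proof.
apply: diameter_le => [|[x1 x2] [y1 y2]]; first exact: diameter_ge0.
apply: le_trans (@distance_le_diameter (kronecker G2 G1) (x2, x1) (y2, y1)).
rewrite {2}/distance; case: leastP => [n pn _|_]; last exact: leey.
apply/distance_leP; exists n => //.
by have /walk_kroneckerP[w2 w1] := path_walk pn; apply/walk_kroneckerP.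
Qed.

Lemma diameter_kroneckerC (G1 G2 : graph) :
  diameter (kronecker G1 G2) = diameter (kronecker G2 G1).
Proof. by apply/eqP; rewrite eq_le !diameter_kroneckerC_le. Qed.

Theorem theorem3p3 (G1 G2 : graph)
    (conn1 : is_connected G1) (conn2 : is_connected G2)
    (diam1 : (1 <= diameter G1)%E) (diam2 : (1 <= diameter G2)%E)
    (odd1 : has_odd_cycle G1) :
  [/\ exponent G1 = exponent G2 ->
        diameter (kronecker G1 G2) = exponent G1,
      (exponent G2 < exponent G1)%E ->
        diameter (kronecker G1 G2) = maxe (exponent G2 + 1)%E (diameter G1)
    & (exponent G1 < exponent G2)%E ->
        diameter (kronecker G1 G2) = maxe (exponent G1 + 1)%E (diameter G2)].
Proof.
split; [|exact: diameter_kronecker_lt|].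
  (* The odd cycle excludes that both exponents are [+oo]. *)
  have [g def1] := exponent_fin conn1 odd1.
  by rewrite def1 => def2; apply: diameter_kronecker_eq.
by rewrite diameter_kroneckerC; apply: diameter_kronecker_lt.
Qed.
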